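(* Let $n\in\{4,5\}$ and $\Omega=\{1,\ldots,n\}$. There is exactly one symmetric association scheme on triples (AST) over $\Omega$ (of any order $m\geq 4$), and it has a lone nontrivial relation, given by $\Omega\times\Omega\times\Omega\setminus\bigcup_{i=0}^3 R_i$, where $R_0,R_1,R_2,R_3$ are the trivial relations.
   Context: Let $\Omega$ be a finite set with $|\Omega|=n\geq 3$. An association scheme on triples (AST) of order $m\geq 4$ on (or over) $\Omega$ is a partition $X=\{R_i\}_{i=0}^m$ of $\Omega\times\Omega\times\Omega$ (into $m+1$ nonempty parts) such that: (1) For each $i\in\{0,\ldots,m\}$ there is a constant $n_i^{(3)}\in\mathbb{N}\cup\{0\}$ such that $|\{z\in\Omega : (x,y,z)\in R_i\}|=n_i^{(3)}$ for any pair of distinct $x,y\in\Omega$. (2) For any $i,j,k,l\in\{0,\ldots,m\}$ there is a constant $p_{ijk}^l\in\mathbb{N}\cup\{0\}$ such that $|\{w\in\Omega : (w,y,z)\in R_i,\ (x,w,z)\in R_j,\ (x,y,w)\in R_k\}|=p_{ijk}^l$ for every $(x,y,z)\in R_l$. (3) For any $i\in\{0,\ldots,m\}$ and $\sigma\in S_3$ there is $j\in\{0,\ldots,m\}$ such that $R_i^\sigma:=\{(x_{\sigma(1)},x_{\sigma(2)},x_{\sigma(3)}) : (x_1,x_2,x_3)\in R_i\}=R_j$. (4) The first four relations are the trivial relations $R_0=\{(x,x,x):x\in\Omega\}$, $R_1=\{(y,x,x):x,y\in\Omega,\ x\neq y\}$, $R_2=\{(x,y,x):x,y\in\Omega,\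 x\neq y\}$, $R_3=\{(x,x,y):x,y\in\Omega,\ x\neq y\}$. The relations $R_4,\ldots,R_m$ are called the nontrivial relations. ASTs are treated as unordered partitions. An AST $\{R_i\}_{i=0}^m$ is symmetric if $R_i^\sigma=R_i$ for every nontrivial relation $R_i$ and every $\sigma\in S_3$. *)

(* Defs.v *)
(* Association schemes on triples, over the Mathematical Components library.
   The triples form the type T * T * T, i.e. (x, y, z) = ((x, y), z). *)
From mathcomp Require Import all_boot perm.

Set Implicit Arguments.
Unset Strict Implicit.
Unset Printing Implicit Defensive.

Section AssociationSchemesOnTriples.

Variable T : finType.

Definition triple : finType := (T * T * T)%type.

Definition triv0 : {set triple} := [set (x, x, x) | x : T].
Definition triv1 : {set triple} := [set (y, x, x) | x in T, y in T & x != y].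
Definition triv2 : {set triple} := [set (x, y, x) | x in T, y in T & x != y].
Definition triv3 : {set triple} := [set (x, x, y) | x in T, y in T & x != y].

Definition trivial_relations : {set {set triple}} :=
  [set triv0; triv1; triv2; triv3].

(* (x_0, x_1, x_2) |-> (x_(s 0), x_(s 1), x_(s 2)) *)
Definition permute_triple (s : 'S_3) (t : triple) : triple :=
  let x := tnth [tuple t.1.1; t.1.2; t.2] in
  (x (s (@Ordinal 3 0 isT)), x (s (@Ordinal 3 1 isT)), x (s (@Ordinal 3 2 isT))).

Definition permute_relation (s : 'S_3) (R : {set triple}) : {set triple} :=
  [set permute_triple s t | t in R].

(* A scheme is an unordered partition X, so its relations are quantified over
   as elements of X instead of by an index. [partition] already requires the
   parts to be nonempty. *)
Record AST (m : nat) (X : {set {set triple}}) : Prop := {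
  AST_points : 3 <= #|T|;
  AST_order : 4 <= m;
  AST_partition : partition X [set: triple];
  AST_card : #|X| = m.+1;
  AST_valency : forall R, R \in X -> exists c : nat,
    forall x y : T, x != y -> #|[set z | (x, y, z) \in R]| = c;
  AST_intersection : forall Ri Rj Rk Rl,
    Ri \in X -> Rj \in X -> Rk \in X -> Rl \in X -> exists p : nat,
    forall x y z : T, (x, y, z) \in Rl ->
      #|[set w | [&& (w, y, z) \in Ri, (x, w, z) \in Rj & (x, y, w) \in Rk]]|
        = p;
  AST_permute : forall R (s : 'S_3), R \in X -> permute_relation s R \in X;
  AST_trivial : trivial_relations \subset X
}.

Definition nontrivial_relations (X : {set {set triple}}) :
  {set {set triple}} := X :\: trivial_relations.

Definition symmetric_AST (m : nat) (X : {set {set triple}}) : Prop :=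
  AST m X /\
  forall R (s : 'S_3), R \in nontrivial_relations X -> permute_relation s R = R.

End AssociationSchemesOnTriples.

Arguments triv0 : clear implicits.
Arguments triv1 : clear implicits.
Arguments triv2 : clear implicits.
Arguments triv3 : clear implicits.
Arguments trivial_relations : clear implicits.

(* Main.v *)
Require Import Defs.
From mathcomp Require Import all_boot perm.
From mathcomp Require Import fingroup action cyclic pgroup sylow.

Set Implicit Arguments.
Unset Strict Implicit.
Unset Printing Implicit Defensive.

(** Existence works over every set of at least three points.  Whether a triple
    lies in one of the four trivial relations or in their complement depends
    only on its equality pattern, [kind], and two triples have the same kind
    exactly when a permutation of the points carries one to the other
    ([kind_transitive]).  The five classes are thus the orbits of the symmetric
    group on triples; every counting condition and the stability under
    permuting coordinates follow by transport along a permutation of the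
    points ([scheme_symmetric_AST]).

    Uniqueness is a divisibility argument.  In a symmetric scheme a nontrivial
    relation R consists of triples of distinct points, and permuting the
    coordinates preserves R, so R is a family of 3-subsets; the valency
    condition says that each pair of points lies in exactly c of them (R is a
    2-(n,3,c) design), with 0 < c <= n - 2.  The triples of R with a given
    first point number (n - 1)c and are paired up by exchanging the last two
    coordinates, so 2 divides (n - 1)c ([even_link]).  All of R has n(n - 1)c
    elements, permuted without fixed points by the cyclic rotation of
    coordinates, so 3 divides n(n - 1)c ([dvd3_relation]).  For n = 4 the first
    condition makes c even, hence c = 2; for n = 5 the second makes c a
    multiple of 3, hence c = 3.  In both cases c = n - 2, so R contains every
    triple of distinct points. *)

(** * Fixed-point-free maps of prime order *)

(** The permutation induced by f generates a p-group, and a p-group acting on A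
    has as many fixed points as A has elements, modulo p. *)
Lemma prime_dvd_card_fixfree (U : finType) (A : {set U}) (f : U -> U) p :
    prime p -> iter p f =1 id ->
    {in A, forall u, f u \in A} -> {in A, forall u, f u != u} ->
  p %| #|A|.
Proof.
move=> p_pr fp fA fixf.
have injf : injective f.
  move=> u v eq_f; rewrite -(fp u) -(fp v).
  by case: p p_pr {fp} => // p _; rewrite !iterSr eq_f.
pose s : {perm U} := perm injf.
have sp : (s ^+ p = 1)%g.
  apply/permP=> u; rewrite perm1 permX -[RHS]fp.
  by apply: eq_iter => v; rewrite permE.
have pS : (p.-group <[s]>)%g.
  rewrite /pgroup; apply: (@pnat_dvd _ p); last by rewrite pnat_id.
  by rewrite -orderE order_dvdn sp.
have actsA : [acts <[s]>%g, on A | 'P]%act.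
  rewrite cycle_subG inE in_setT inE; apply/subsetP=> u Au.
  by rewrite inE /= apermE permE fA.
have := pgroup_fix_mod pS actsA.
rewrite /dvdn => ->; rewrite (_ : ('Fix_(_ | _)(_))%g = set0) ?cards0 ?mod0n //.
apply/setP=> u; rewrite in_setI in_set0 afix_cycle; apply/negP=> /andP[Au].
by move=> /afix1P/eqP; rewrite /= apermE permE; apply/negP/fixf.
Qed.

(** * Equality patterns of triples *)

Section Kinds.

Variable T : finType.
Implicit Types (R : {set triple T}) (t u : triple T) (x y z : T).
Implicit Types (i : nat) (g : {perm T}) (s : 'S_3).

(** The values 0 to 3 are the indices of the trivial relations; 4 means three
    distinct points. *)
Definition kind t : nat :=
  let: (x, y, z) := t in
  if x == y then (if y == z then 0 else 3)
  else if y == z then 1 else if x == z then 2 else 4.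

Definition kind_class i : {set triple T} := [set t | kind t == i].

Definition map_triple g t : triple T := (g t.1.1, g t.1.2, g t.2).

Lemma kind_lt5 t : kind t < 5.
Proof. by case: t => [[x y] z] /=; do !case: ifP. Qed.

Lemma kind_inj_pattern x y z x' y' z' :
    kind (x, y, z) = kind (x', y', z') ->
  [/\ (x == y) = (x' == y'), (y == z) = (y' == z') & (x == z) = (x' == z')].
Proof.
rewrite /kind; have [->|nxy] := eqVneq x y; have [->|nxy'] := eqVneq x' y'.
- by case: (y == z); case: (y' == z').
- by case: (y == z); case: (y' == z'); case: (x' == z').
- by case: (y == z); case: (y' == z'); case: (x == z).
- have [<-|nyz] := eqVneq y z; have [<-|nyz'] := eqVneq y' z';
    rewrite ?(negbTE nxy) ?(negbTE nxy') //;
  by [case: (x' == z') | case: (x == z) | case: (x == z); case: (x' == z')].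
Qed.

Lemma kind_map_triple g t : kind (map_triple g t) = kind t.
Proof. by case: t => [[x y] z]; rewrite /kind /= !(inj_eq perm_inj). Qed.

(** Three transpositions in a row place the three coordinates one at a time;
    equality of the patterns ensures that each transposition leaves the
    coordinates placed before it where they are. *)
Lemma kind_transitive t u : kind t = kind u -> exists g, u = map_triple g t.
Proof.
case: t u => [[x y] z] [[x' y'] z'] /kind_inj_pattern[exy eyz exz].
pose g1 := tperm x x'; pose g2 := tperm (g1 y) y'.
pose g3 := tperm (g2 (g1 z)) z'.
have g1x : g1 x = x' by rewrite tpermL.
have g2y : g2 (g1 y) = y' by rewrite tpermL.
have g2x : g2 x' = x'.
  have [eq_xy|ne_xy] := boolP (x == y).
    have eq_xy' : x' = y' by apply/eqP; rewrite -exy.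
    by rewrite [in RHS]eq_xy' -g2y -(eqP eq_xy) g1x.
  by rewrite tpermD // -?g1x ?(inj_eq perm_inj) eq_sym // g1x -exy.
have fix3 w w' : g2 (g1 w) = w' -> (w == z) = (w' == z') -> g3 w' = w'.
  move=> gw ewz; have [eq_wz|ne_wz] := boolP (w == z).
    rewrite /g3 -(eqP eq_wz) gw.
    by move: ewz; rewrite eq_wz => /esym/eqP ->; rewrite tpermL.
  by rewrite tpermD // -?gw ?(inj_eq perm_inj) eq_sym // gw -ewz.
exists (g1 * g2 * g3)%g; rewrite /map_triple /= !permM g1x g2y g2x tpermL.
by rewrite (fix3 x) ?(fix3 y) // g1x.
Qed.

(** Moving the points commutes with rearranging the coordinates; this is what
    makes the orbits of the symmetric group stable under rearrangement. *)
Lemma permute_triple_map s g t :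
  permute_triple s (map_triple g t) = map_triple g (permute_triple s t).
Proof.
rewrite /permute_triple /map_triple /=.
have tnthg (i : 'I_3) : tnth [tuple g t.1.1; g t.1.2; g t.2] i
    = g (tnth [tuple t.1.1; t.1.2; t.2] i).
  by case: i => [[|[|[|]]]].
by rewrite !tnthg.
Qed.

Lemma permute_kind_class s t :
  permute_relation s (kind_class (kind t)) =
  kind_class (kind (permute_triple s t)).
Proof.
apply/setP=> u; rewrite inE; apply/imsetP/eqP => [[v]|].
  rewrite inE => /eqP/esym/kind_transitive[g ->] ->.
  by rewrite permute_triple_map kind_map_triple.
move=> /esym/kind_transitive[g ->]; exists (map_triple g t).
  by rewrite inE kind_map_triple.
by rewrite permute_triple_map.
Qed.

Lemma kind_eq4 x y z : (kind (x, y, z) == 4) = [&& x != y, y != z & x != z].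
Proof. by rewrite /kind; do !case: ifP. Qed.

Lemma kind_permute_eq4 s t : kind t = 4 -> kind (permute_triple s t) = 4.
Proof.
move=> /eqP; case: t => [[x y] z]; rewrite kind_eq4 => /and3P[nxy nyz nxz].
have uniq_t : uniq [tuple x; y; z] by rewrite /= !inE negb_or nxy nyz nxz.
apply/eqP; rewrite kind_eq4 /=.
by rewrite !(inj_eq (tuple_uniqP _ uniq_t)) !(inj_eq perm_inj).
Qed.

Lemma kind_class0 : kind_class 0 = triv0 T.
Proof.
apply/setP=> -[[x y] z]; rewrite inE /kind.
apply/idP/imsetP=> [|[w _ [-> -> ->]]].
  have [->|_] := eqVneq x y; have [->|_] := eqVneq y z => //; first by exists z.
  by case: ifP.
by rewrite !eqxx.
Qed.

Lemma kind_class1 : kind_class 1 = triv1 T.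
Proof.
apply/setP=> -[[x y] z]; rewrite inE /kind; apply/idP/imset2P=> [|[v w _ ]].
  have [->|nxy] := eqVneq x y; first by case: ifP.
  have [<- _|_] := eqVneq y z; last by case: ifP.
  by exists y x; rewrite // inE eq_sym.
by rewrite inE => /andP[_ nvw] [-> -> ->];
  rewrite eqxx [w == v]eq_sym (negbTE nvw).
Qed.

Lemma kind_class2 : kind_class 2 = triv2 T.
Proof.
apply/setP=> -[[x y] z]; rewrite inE /kind; apply/idP/imset2P=> [|[v w _ ]].
  have [->|nxy] := eqVneq x y; first by case: ifP.
  have [//|_] := eqVneq y z; have [<- _|//] := eqVneq x z.
  by exists x y; rewrite // inE.
rewrite inE => /andP[_ nvw] [-> -> ->].
by rewrite eqxx [w == v]eq_sym (negbTE nvw).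
Qed.

Lemma kind_class3 : kind_class 3 = triv3 T.
Proof.
apply/setP=> -[[x y] z]; rewrite inE /kind; apply/idP/imset2P=> [|[v w _ ]].
  have [->|nxy] := eqVneq x y; last by case: ifP => // _; case: ifP.
  by have [//|nyz _] := eqVneq y z; exists y z; rewrite // inE.
by rewrite inE => /andP[_ nvw] [-> -> ->]; rewrite eqxx (negbTE nvw).
Qed.

Lemma trivial_relationsE :
  trivial_relations T =
  [set kind_class 0; kind_class 1; kind_class 2; kind_class 3].
Proof. by rewrite kind_class0 kind_class1 kind_class2 kind_class3. Qed.

Lemma kind_class4 :
  kind_class 4 =
  [set: triple T] :\: (triv0 T :|: triv1 T :|: triv2 T :|: triv3 T).
Proof.
rewrite -kind_class0 -kind_class1 -kind_class2 -kind_class3.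
apply/setP=> t; rewrite !inE andbT.
by have := kind_lt5 t; case: (kind t) => [|[|[|[|[|]]]]].
Qed.

(** * The scheme of all equality patterns *)

Definition scheme : {set {set triple T}} :=
  kind_class 4 |: trivial_relations T.

Section AtLeastThreePoints.

Hypothesis T3 : 3 <= #|T|.

(** The triples of kind 4 are the reason for requiring three points. *)
Lemma kind_onto i : i < 5 -> exists t, kind t = i.
Proof.
have /card_gt2P[x [y [z [_ [nxy nyz nzx]]]]] : 2 < #|T| by [].
have nxz : x != z by rewrite eq_sym.
case: i => [|[|[|[|[|]]]]] // _; [exists (x, x, x) | exists (y, x, x)
  | exists (x, y, x) | exists (x, x, y) | exists (x, y, z)];
  by rewrite /kind ?eqxx ?[y == x]eq_sym
    ?(negbTE nxy) ?(negbTE nyz) ?(negbTE nxz).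
Qed.

Lemma eq_kind_class i j :
  i < 5 -> (kind_class i == kind_class j) = (i == j).
Proof.
move=> /kind_onto[t <-]; apply/eqP/eqP=> [/setP/(_ t)|->//].
by rewrite !inE eqxx => /esym/eqP.
Qed.

(** In this form the scheme is visibly the set of fibres of [kind], hence a
    partition. *)
Lemma schemeE : scheme = [set kind_class (kind t) | t : triple T].
Proof.
apply/setP=> R; rewrite /scheme trivial_relationsE !inE -!orbA.
apply/idP/imsetP.
  have fibre i : i < 5 ->
      exists2 t, t \in triple T & kind_class i = kind_class (kind t).
    by move=> /kind_onto[t <-]; exists t.
  by move=> /orP[|/or4P[]] /eqP ->; apply: fibre.
move=> [t _ ->]; have := kind_lt5 t.
by case: (kind t) => [|[|[|[|[|]]]]] // _; rewrite eqxx ?orbT.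
Qed.

Lemma partition_scheme : partition scheme [set: triple T].
Proof.
have -> : scheme = preim_partition kind [set: triple T].
  rewrite schemeE; apply/setP=> R.
  apply/imsetP/imsetP=> -[t _ ->]; exists t => //;
  by apply/setP=> u; rewrite !inE /= eq_sym.
exact: preim_partitionP.
Qed.

Lemma card_scheme : #|scheme| = 5.
Proof.
rewrite /scheme trivial_relationsE -!setUA !cardsU1 cards1 !inE.
by rewrite !eq_kind_class.
Qed.

(** The numbers in the valency and intersection conditions are read off at one
    reference triple of the class; a permutation g of the points carrying it to
    any other triple of the class is a bijection between the sets counted. *)
Lemma scheme_symmetric_AST : symmetric_AST 4 scheme.
Proof.
split; last first.
  move=> R s; rewrite !inE => /andP[/negbTE -> /[!orbF] /eqP ->].
  have [t t4] := @kind_onto 4 isT.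
  by rewrite -{1}t4 permute_kind_class kind_permute_eq4.
split=> //.
- exact: partition_scheme.
- exact: card_scheme.
- rewrite schemeE => _ /imsetP[t _ ->].
  have /card_gt1P[x0 [y0 [_ _ nxy0]]] : 1 < #|T| by apply: leq_trans T3.
  exists #|[set z | (x0, y0, z) \in kind_class (kind t)]| => x y nxy.
  (* A pair of distinct points x, y is treated as the triple (x, y, y). *)
  have [|g [-> -> _]] := @kind_transitive (x0, y0, y0) (x, y, y).
    by rewrite /kind !eqxx (negbTE nxy) (negbTE nxy0).
  rewrite -(card_preimset _ (@perm_inj _ g)); apply: eq_card => z.
  by rewrite !in_set -(kind_map_triple g (x0, y0, z)).
- rewrite schemeE => Ri Rj Rk Rl /imsetP[ti _ ->] /imsetP[tj _ ->].
  move=> /imsetP[tk _ ->] /imsetP[[[x0 y0] z0] _ ->].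
  exists #|[set w | [&& (w, y0, z0) \in kind_class (kind ti),
    (x0, w, z0) \in kind_class (kind tj) &
    (x0, y0, w) \in kind_class (kind tk)]]|.
  move=> x y z; rewrite inE => /eqP/esym/kind_transitive[g [-> -> ->]].
  rewrite -(card_preimset _ (@perm_inj _ g)); apply: eq_card => w.
  rewrite !in_set -(kind_map_triple g (w, y0, z0)).
  by rewrite -(kind_map_triple g (x0, w, z0)) -(kind_map_triple g (x0, y0, w)).
- rewrite schemeE => R s /imsetP[t _ ->]; rewrite permute_kind_class.
  exact: imset_f.
- exact: subsetUr.
Qed.

End AtLeastThreePoints.

(** * Valencies *)

(** When R is a family of 3-subsets, listed in all orders, this says that R is a
    2-(n,3,c) design. *)
Definition pair_regular R (c : nat) : Prop :=
  forall x y, x != y -> #|[set z | (x, y, z) \in R]| = c.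

Lemma card_off_pair x y : x != y -> #|~: [set x; y]| = #|T| - 2.
Proof. by move=> nxy; rewrite cardsCs setCK cards2 nxy. Qed.

Lemma third_point_off_pair R x y :
  R \subset kind_class 4 -> [set z | (x, y, z) \in R] \subset ~: [set x; y].
Proof.
move=> subR; apply/subsetP=> w; rewrite !inE => /(subsetP subR).
by rewrite inE kind_eq4 negb_or ![w == _]eq_sym => /and3P[_ -> ->].
Qed.

(** The third points that R attaches to a pair already number n - 2, so they
    are all the points off the pair. *)
Lemma valency_full R c : R \subset kind_class 4 -> pair_regular R c ->
  c = #|T| - 2 -> R = kind_class 4.
Proof.
move=> subR valR c_max; apply/eqP; rewrite eqEsubset subR.
apply/subsetP=> -[[x y] z]; rewrite inE kind_eq4 => /and3P[nxy nyz nxz].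
have /eqP/setP/(_ z) : [set z | (x, y, z) \in R] == ~: [set x; y].
  by rewrite eqEcard third_point_off_pair //= valR // card_off_pair // c_max.
by rewrite !inE negb_or ![z == _]eq_sym nyz nxz.
Qed.

Lemma valency_bounds R c : R != set0 -> R \subset kind_class 4 -> pair_regular R c ->
  0 < c <= #|T| - 2.
Proof.
move=> /set0Pn[[[x y] z] Rt] subR valR.
have /and3P[nxy _ _] : [&& x != y, y != z & x != z].
  by have := subsetP subR _ Rt; rewrite inE kind_eq4.
rewrite -(valR x y nxy); apply/andP; split.
  by apply/card_gt0P; exists z; rewrite inE.
rewrite -(card_off_pair nxy); apply: subset_leq_card.
exact: third_point_off_pair.
Qed.

(** There are n - 1 choices of the second point, each completed in c ways. *)
Lemma card_link R c x : R \subset kind_class 4 -> pair_regular R c ->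
  #|[set t in R | t.1.1 == x]| = #|T|.-1 * c.
Proof.
move=> subR valR.
rewrite -sum1_card (partition_big (fun t => t.1.2) (predC1 x)) /=; last first.
  move=> [[x' y] z]; rewrite inE => /andP[/(subsetP subR)].
  by rewrite inE kind_eq4 /= eq_sym => /and3P[nxy _ _] /eqP <-.
rewrite -(cardC1 x) -sum_nat_const; apply: eq_bigr => y /= nyx.
have inj_pair : injective (fun z : T => (x, y, z) : triple T) by move=> z w [].
rewrite -(valR x y) 1?eq_sym // -(card_imset _ inj_pair) sum1dep_card.
apply: eq_card => -[[x' y'] z]; rewrite !inE /=; apply/idP/imsetP.
  move=> /andP[/andP[Rt /eqP eqx] /eqP eqy].
  by exists z; rewrite ?inE -?eqx -?eqy.
by move=> [w]; rewrite inE => Rt [-> -> ->]; rewrite Rt !eqxx.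
Qed.

Lemma card_relation R c : R \subset kind_class 4 -> pair_regular R c ->
  #|R| = #|T| * (#|T|.-1 * c).
Proof.
move=> subR valR; rewrite -sum1_card.
rewrite (partition_big (fun t => t.1.1) predT) //= -sum_nat_const.
apply: eq_bigr => x _; rewrite -(card_link x subR valR) -sum1_card.
by apply: eq_bigl => t; rewrite inE.
Qed.

Definition swap23 t : triple T := (t.1.1, t.2, t.1.2).
Definition rotate t : triple T := (t.1.2, t.2, t.1.1).

Lemma permute_swap23 t :
  permute_triple (tperm (@Ordinal 3 1 isT) (@Ordinal 3 2 isT)) t = swap23 t.
Proof. by rewrite /permute_triple !permE. Qed.

Lemma permute_rotate t :
  permute_triple (tperm (@Ordinal 3 0 isT) (@Ordinal 3 1 isT)
    * tperm (@Ordinal 3 0 isT) (@Ordinal 3 2 isT))%g t = rotate t.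
Proof. by rewrite /permute_triple !permM !permE. Qed.

(** * Symmetric schemes on four or five points *)

Section Uniqueness.

Variables (m : nat) (X : {set {set triple T}}).
Hypothesis symX : symmetric_AST m X.

(** A triple of another kind lies in a trivial relation, which is a part of X
    other than R. *)
Lemma nontrivial_sub_kind4 R :
  R \in nontrivial_relations X -> R \subset kind_class 4.
Proof.
case: symX => -[_ _ /and3P[_ /trivIsetP disjX _] _ _ _ _ trivX] _.
rewrite in_setD => /andP[ntR XR]; apply/subsetP=> t Rt.
rewrite inE; apply: contraT => kt.
have tr : kind_class (kind t) \in trivial_relations T.
  rewrite trivial_relationsE !inE; have := kind_lt5 t.
  by case: (kind t) kt => [|[|[|[|[|]]]]] // _ _; rewrite eqxx ?orbT.
have neqR : R != kind_class (kind t) by apply: contraNneq ntR => ->.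
have disj := disjX _ _ XR (subsetP trivX _ tr) neqR.
by have := disjointFr disj Rt; rewrite inE eqxx.
Qed.

Lemma nontrivial_permute R s t :
  R \in nontrivial_relations X -> t \in R -> permute_triple s t \in R.
Proof.
by case: symX => _ symR ntR Rt; rewrite -(symR R s ntR); apply: imset_f.
Qed.

(** Exchanging the last two coordinates pairs up the triples of R with a given
    first point, since their last two coordinates differ. *)
Lemma even_link R c : 0 < #|T| -> R \in nontrivial_relations X ->
    pair_regular R c ->
  2 %| #|T|.-1 * c.
Proof.
move=> /card_gt0P[x _] ntR valR; have subR := nontrivial_sub_kind4 ntR.
rewrite -(card_link x subR valR).
apply: (prime_dvd_card_fixfree (f := swap23)) => // [[[y z] w]//|t|[[y z] w]].
  rewrite !inE => /andP[Rt tx].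
  by rewrite -permute_swap23 nontrivial_permute // permute_swap23.
rewrite inE => /andP[Rt _]; have := subsetP subR _ Rt.
by rewrite inE kind_eq4 /swap23 /= !xpair_eqE eqxx /= [w == z]eq_sym
  => /and3P[_ /negbTE -> _].
Qed.

(** Rotating the coordinates splits R into 3-cycles. *)
Lemma dvd3_relation R c : R \in nontrivial_relations X ->
    pair_regular R c ->
  3 %| #|T| * (#|T|.-1 * c).
Proof.
move=> ntR valR; have subR := nontrivial_sub_kind4 ntR.
rewrite -(card_relation subR valR).
apply: (prime_dvd_card_fixfree (f := rotate)) =>
  // [[[y z] w]//|t Rt|[[y z] w] Rt].
  by rewrite -permute_rotate nontrivial_permute.
have := subsetP subR _ Rt.
by rewrite inE kind_eq4 /rotate /= !xpair_eqE eq_sym => /and3P[/negbTE ->].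
Qed.

Lemma nontrivial_relation_full R :
  #|T| = 4 \/ #|T| = 5 -> R \in nontrivial_relations X -> R = kind_class 4.
Proof.
move=> T45 ntR; have subR := nontrivial_sub_kind4 ntR.
have [[T3 _ /and3P[_ _ X0] _ valX _ _ _] _] := symX.
have XR : R \in X by move: ntR; rewrite inE => /andP[].
have [c valR] := valX _ XR.
have nR0 : R != set0 by apply: contraNneq X0 => <-.
have := valency_bounds nR0 subR valR.
have := dvd3_relation ntR valR; have := even_link (ltnW (ltnW T3)) ntR valR.
have := valency_full subR valR.
(* The bounds leave c in {1, 2} for four points and in {1, 2, 3} for five;
   evaluating the two divisibilities excludes every value but n - 2. *)
by case: T45 => ->; case: c {valR} => [|[|[|[|c]]]] // full _ _ _; apply: full.
Qed.

(** A triple of distinct points lies in some part of X; that part is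
    nontrivial, so X does have a nontrivial relation. *)
Lemma nontrivial_relations_kind4 :
  #|T| = 4 \/ #|T| = 5 -> nontrivial_relations X = [set kind_class 4].
Proof.
move=> T45; have full R := @nontrivial_relation_full R T45.
have [[T3 _ partX _ _ _ _ _] _] := symX.
have [t t4] := kind_onto T3 (isT : 4 < 5).
have Xt : pblock X t \in X by rewrite pblock_mem // (cover_partition partX).
have ntt : pblock X t \in nontrivial_relations X.
  rewrite inE Xt andbT; apply/negP => tr.
  have : t \in pblock X t by rewrite mem_pblock (cover_partition partX).
  move: tr; rewrite trivial_relationsE !inE -!orbA.
  by case/or4P=> /eqP ->; rewrite inE t4.
apply/setP=> R; rewrite in_set1; apply/idP/eqP=> [/full //|->].
by rewrite -(full _ ntt).
Qed.

Lemma symmetric_AST_scheme : #|T| = 4 \/ #|T| = 5 -> X = scheme.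
Proof.
move=> T45; have [[_ _ _ _ _ _ _ trivX] _] := symX.
rewrite /scheme -(nontrivial_relations_kind4 T45) setUC.
by rewrite -{1}(setID X (trivial_relations T)) (setIidPr trivX).
Qed.

End Uniqueness.

End Kinds.

Theorem mainTheorem3 (n : nat) (hn : n = 4 \/ n = 5) :
  (exists! X : {set {set triple 'I_n}}, exists m : nat, symmetric_AST m X) /\
  (forall (m : nat) (X : {set {set triple 'I_n}}), symmetric_AST m X ->
     nontrivial_relations X =
       [set [set: triple 'I_n] :\:
              (triv0 'I_n :|: triv1 'I_n :|: triv2 'I_n :|: triv3 'I_n)]).
Proof.
have n45 : #|'I_n| = 4 \/ #|'I_n| = 5 by rewrite card_ord.
split=> [|m X symX].
  exists (scheme 'I_n); split=> [|X [m symX]].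
    by exists 4; apply: scheme_symmetric_AST; case: n45 => ->.
  exact/esym/(symmetric_AST_scheme symX).
by rewrite (nontrivial_relations_kind4 symX) // kind_class4.
Qed.
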